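(* For every pair of natural numbers $1\le k<n$ there exists a diffeology on $\mathbb{R}^n$ such that the projection $\pi:\mathbb{R}^n\to\mathbb{R}^k$ onto the first $k$ coordinates ($\mathbb{R}^k$ with the standard diffeology) is smooth and is a diffeological vector pseudo-bundle that is locally non-trivial in at least one point of $\mathbb{R}^k$.
   Context: Diffeological vector pseudo-bundle: a smooth map $\pi:V\to X$ of diffeological spaces such that each fibre carries a real vector space structure and the fibrewise addition $V\times_XV\to V$, the scalar multiplication $\mathbb{R}\times V\to V$, and the zero section $X\to V$ are smooth ($V\times_XV\subset V\times V$ with the subset diffeology of the product diffeology, $\mathbb{R}$ standard). For the projection $\mathbb{R}^n=\mathbb{R}^k\times\mathbb{R}^{n-k}\to\mathbb{R}^k$, each fibre $\{x\}\times\mathbb{R}^{n-k}$ has the vector space structure of $\mathbb{R}^{n-k}$. The standard diffeology of $\mathbb{R}^k$ consists of all ordinary smooth maps from domains. A subset of a diffeological space is D-open if its preimage under every plot is open. The pseudo-bundle is locally trivial at $x\in X$ if there are a D-open neighbourhood $U$ of $x$, a diffeological vector space $F$, and a diffeomorphism $\pi^{-1}(U)\cong U\times F$ (subset and product diffeologies) that commutes with the projections to $U$ and is linear on fibres; otherwise it is locally non-trivial at $x$. *)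

(* Defs.v *)
From HB Require Import structures.
From mathcomp Require Import all_boot all_order all_algebra.
From mathcomp Require Import all_classical all_reals all_analysis.
Import Order.TTheory GRing.Theory Num.Theory.
Import numFieldNormedType.Exports.

Set Implicit Arguments.
Unset Strict Implicit.
Unset Printing Implicit Defensive.

Local Open Scope classical_set_scope.
Local Open Scope ring_scope.

Section Smooth.
Variables (R : realType) (m : nat) (W : normedModType R).

(* [Ck_on j U f]: [f] is of class C^j on the open set [U]; C^0 is continuity,
   and C^(j+1) is Frechet differentiability with directional derivatives of
   class C^j. The values of [f] outside [U] are irrelevant. *)
Fixpoint Ck_on (j : nat) (U : set 'rV[R]_m) (f : 'rV[R]_m -> W) : Prop :=
  if j is j'.+1 then
    (forall x, U x -> differentiable f x) /\ (forall v, Ck_on j' U ('D_v f))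
  else forall x, U x -> {for x, continuous f}.

Definition smooth_on (U : set 'rV[R]_m) (f : 'rV[R]_m -> W) : Prop :=
  forall j, Ck_on j U f.

End Smooth.

Section SmoothTheory.
Variable R : realType.
Implicit Types (m l j : nat).

Lemma near_eq_continuous (V W : topologicalType) (f g : V -> W) (x : V) :
  (\forall y \near x, f y = g y) ->
  {for x, continuous f} -> {for x, continuous g}.
Proof.
move=> fg; rewrite /prop_for /continuous_at -(nbhs_singleton fg) => cf.
exact: cvg_trans (near_eq_cvg fg) cf.
Qed.

Lemma near_eq_differentiable (V W : normedModType R) (f g : V -> W) (x : V) :
  (\forall y \near x, f y = g y) -> differentiable f x -> differentiable g x.
Proof.
move=> fg /diff_locallyP[cf ef].
have eg : g \o shift x = cst (g x) + 'd f x +o_ (0 : V) id.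
  apply/eqaddoP => e e0; have /eqaddoP/(_ e e0) := ef.
  move: (fg); rewrite (near_shift 0 x) => fg0 H.
  have fgx := nbhs_singleton fg.
  near=> y.
  have -> : (g \o shift x - (cst (g x) + 'd f x)) y =
      (f \o shift x - (cst (f x) + 'd f x)) y.
    rewrite -[LHS]/(g (y + x) - (g x + 'd f x y)).
    rewrite -[RHS]/(f (y + x) - (f x + 'd f x y)) fgx.
    congr (_ - _); have : (fun z => f z = g z) ((shift (x - 0)) y).
      by near: y.
    by rewrite /= subr0 => ->.
  by near: y.
have dgf := diff_unique cf eg.
by apply/diff_locallyP; rewrite dgf.
Unshelve. all: by end_near. Qed.

Lemma Ck_ext m (W : normedModType R) j (U : set 'rV[R]_m)
    (f g : 'rV[R]_m -> W) :
  open U -> {in U, f =1 g} -> Ck_on j U f -> Ck_on j U g.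
Proof.
move=> oU; elim: j f g => [|j IH] f g fg.
all: have nfg x : U x -> \forall y \near x, f y = g y.
1,3: by move=> Ux; near=> y; apply: fg; apply/mem_set; near: y;
  exact: open_nbhs_nbhs.
  by move=> cf x Ux; apply: near_eq_continuous (cf _ Ux); exact: nfg.
move=> [df Df]; split => [x Ux|v].
  by apply: near_eq_differentiable (df _ Ux); exact: nfg.
by apply: IH (Df v) => x /set_mem Ux; apply: near_eq_derive; exact: nfg.
Unshelve. all: by end_near. Qed.

Lemma Ck_sub m (W : normedModType R) j (U U' : set 'rV[R]_m)
    (f : 'rV[R]_m -> W) :
  U' `<=` U -> Ck_on j U f -> Ck_on j U' f.
Proof.
move=> sU; elim: j f => [|j IH] f /=; first by move=> cf x /sU; exact: cf.
by move=> [df Df]; split => [x /sU|v]; [exact: df|exact: IH].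
Qed.

Lemma Ck_local m (W : normedModType R) j (U : set 'rV[R]_m)
    (f : 'rV[R]_m -> W) :
  (forall u, U u -> exists2 U', U' u & Ck_on j U' f) -> Ck_on j U f.
Proof.
elim: j f => [|j IH] f H /=.
  by move=> x Ux; have [U' U'x] := H _ Ux; apply.
split => [x Ux|v]; first by have [U' U'x [df _]] := H _ Ux; exact: df.
apply: IH => u Uu; have [U' U'x [_ Df]] := H _ Uu.
by exists U' => //; exact: Df.
Qed.

Lemma Ck_pred m (W : normedModType R) j (U : set 'rV[R]_m)
    (f : 'rV[R]_m -> W) :
  Ck_on j.+1 U f -> Ck_on j U f.
Proof.
elim: j f => [|j IH] f [df Df].
  by move=> x Ux; exact/differentiable_continuous/df.
by split => // v; apply: IH.
Qed.

Lemma Ck_cst m (W : normedModType R) j (U : set 'rV[R]_m) (c : W) :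
  Ck_on j U (fun=> c).
Proof.
elim: j c => [|j IH] c; first by move=> x _; exact: cst_continuous.
split => [x _|v]; first exact: differentiable_cst.
rewrite (_ : 'D_v _ = fun=> 0); first exact: IH.
by apply/funext => x; rewrite derive_cst.
Qed.

Lemma CkD m (W : normedModType R) j (U : set 'rV[R]_m)
    (f g : 'rV[R]_m -> W) :
  open U -> Ck_on j U f -> Ck_on j U g -> Ck_on j U (fun x => f x + g x).
Proof.
move=> oU; elim: j f g => [|j IH] f g.
  by move=> cf cg x Ux; apply: continuousD; [exact: cf|exact: cg].
move=> [df Df] [dg Dg]; split => [x Ux|v].
  by apply: differentiableD; [exact: df|exact: dg].
apply: Ck_ext (IH _ _ (Df v) (Dg v)) => // x /set_mem Ux.
by rewrite deriveD//; apply: diff_derivable; [exact: df|exact: dg].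
Qed.

Lemma Ck_sum m (W : normedModType R) j (U : set 'rV[R]_m) l
    (f : 'I_l -> 'rV[R]_m -> W) :
  open U -> (forall i, Ck_on j U (f i)) ->
  Ck_on j U (fun x => \sum_i f i x).
Proof.
move=> oU; elim: l f => [|l IH] f cf.
  by under eq_fun do rewrite big_ord0; exact: Ck_cst.
by under eq_fun do rewrite big_ord_recl; apply: CkD => //; exact: IH.
Qed.

Fact scale_is_bilinear (W : normedModType R) :
  bilinear_for
    (GRing.Scale.Law.clone _ _ *:%R _) (GRing.Scale.Law.clone _ _ *:%R _)
    (@GRing.scale R W).
Proof.
split=> [u'|u] a x y /=; first by rewrite scalerDl scalerA.
by rewrite scalerDr !scalerA mulrC.
Qed.

Lemma is_diff_scale (m : nat) (W : normedModType R) (a : 'rV[R]_m -> R)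
    (f : 'rV[R]_m -> W) x :
  differentiable a x -> differentiable f x ->
  is_diff x (fun y => a y *: f y)
    (fun v => a x *: 'd f x v + 'd a x v *: f x).
Proof.
move=> da df.
pose M := bilinear_isBilinear.Build R R W W _ _ (@GRing.scale R W)
  (@scale_is_bilinear W).
pose L : {bilinear R -> W -> W} := HB.pack (@GRing.scale R W) M.
have cL : continuous (fun p : R * W => L p.1 p.2) by move=> ?; exact: scale_continuous.
have dL (p : R * W) : is_diff p (fun q => L q.1 q.2)
    (fun q => L p.1 q.2 + L q.1 p.2).
  by apply: DiffDef; [exact: differentiable_bilin|exact: diff_bilin].
have ia : is_diff x a ('d a x) by apply: DiffDef.
have jf : is_diff x f ('d f x) by apply: DiffDef.
exact: (is_diff_comp (is_diff_pair ia jf) (dL (a x, f x))).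
Qed.

Lemma CkZ m (W : normedModType R) j (U : set 'rV[R]_m)
    (a : 'rV[R]_m -> R) (f : 'rV[R]_m -> W) :
  open U -> Ck_on j U a -> Ck_on j U f -> Ck_on j U (fun x => a x *: f x).
Proof.
move=> oU; elim: j a f => [|j IH] a f.
  move=> ca cf x Ux; apply: continuousZ; [exact: ca|exact: cf].
move=> Ca Cf; have [da Da] := Ca; have [df Df] := Cf.
have H x : U x -> _ := fun Ux => is_diff_scale (da x Ux) (df x Ux).
split => [x /H[]//|v].
apply: (@Ck_ext _ _ _ _ (fun x => a x *: 'D_v f x + 'D_v a x *: f x)) => //.
  move=> x /set_mem Ux; have [d e] := H _ Ux.
  rewrite (deriveE _ d) e.
  by rewrite !deriveE//; [exact: da|exact: df].
by apply: CkD => //; apply: IH; [exact: Ck_pred|exact: Df|exact: Da|exact: Ck_pred].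
Qed.

Lemma Ck_coord m l j (U : set 'rV[R]_m) (f : 'rV[R]_m -> 'rV[R]_l) i :
  open U -> Ck_on j U f -> Ck_on j U (fun x => f x 0 i : R).
Proof.
move=> oU; elim: j f => [|j IH] f.
  move=> cf x Ux; apply: (@continuous_comp _ _ _ f (fun M : 'rV_l => M 0 i)).
    exact: cf.
  exact: coord_continuous.
move=> [df Df]; split => [x Ux|v].
  apply: (@differentiable_comp _ _ _ _ f (fun M : 'rV_l => M 0 i : R)).
    exact: df.
  exact: differentiable_coord.
apply: Ck_ext (IH _ (Df v)) => // x /set_mem Ux.
by rewrite derive_mx ?mxE//; apply/diff_derivable/df.
Qed.

Lemma Ck_comp m l (W : normedModType R) j (U : set 'rV[R]_m)
    (U' : set 'rV[R]_l) (f : 'rV[R]_m -> W) (h : 'rV[R]_l -> 'rV[R]_m) :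
  open U' -> (forall x, U' x -> U (h x)) ->
  Ck_on j U f -> Ck_on j U' h -> Ck_on j U' (f \o h).
Proof.
move=> oU' hU; elim: j f => [|j IH] f.
  by move=> cf ch x U'x; apply: continuous_comp; [exact: ch|exact/cf/hU].
move=> [df Df] Ch; have [dh Dh] := Ch.
split => [x U'x|v].
  by apply: differentiable_comp; [exact: dh|exact/df/hU].
apply: (@Ck_ext _ _ _ _
  (fun x => \sum_(i < m) ('D_v h x) 0 i *: ('D_(delta_mx 0 i) f \o h) x)) => //.
  move=> x /set_mem U'x /=.
  have dhx := dh x U'x; have dfx := df _ (hU _ U'x).
  rewrite [RHS]deriveE; last exact: differentiable_comp.
  rewrite diff_comp//= -(deriveE _ dhx) [in RHS](row_sum_delta ('D_v h x)).
  rewrite linear_sum; apply: eq_bigr => i _.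
  by rewrite linearZ/= (deriveE _ dfx).
apply: Ck_sum => // i; apply: CkZ => //.
  by apply: Ck_coord => //; exact: Dh.
by apply: IH (Df _) _ => //; exact: Ck_pred.
Qed.

End SmoothTheory.
(* A parametrization of [X] with domain [U] is represented by a total function
   on R^m whose values outside [U] are irrelevant, which is what [plot_ext]
   expresses. *)
Record diffeology (R : realType) (X : Type) := Diffeology {
  plot : forall m : nat, set 'rV[R]_m -> ('rV[R]_m -> X) -> Prop;
  plot_open : forall m (U : set 'rV[R]_m) (p : 'rV[R]_m -> X),
    plot U p -> open U;
  plot_ext : forall m (U : set 'rV[R]_m) (p q : 'rV[R]_m -> X),
    {in U, p =1 q} -> plot U p -> plot U q;
  plot_cst : forall m (U : set 'rV[R]_m) (x : X),
    open U -> plot U (fun=> x);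
  plot_local : forall m (U : set 'rV[R]_m) (p : 'rV[R]_m -> X),
    open U ->
    (forall u, U u -> exists U' : set 'rV[R]_m,
       [/\ open U', U' u, U' `<=` U & plot U' p]) ->
    plot U p;
  plot_comp : forall m l (U : set 'rV[R]_m) (U' : set 'rV[R]_l)
      (p : 'rV[R]_m -> X) (h : 'rV[R]_l -> 'rV[R]_m),
    plot U p -> open U' -> smooth_on U' h -> h @` U' `<=` U ->
    plot U' (p \o h)
}.

Arguments plot {R X} d {m} U p.

Definition smooth (R : realType) (X Y : Type) (DX : diffeology R X)
    (DY : diffeology R Y) (f : X -> Y) : Prop :=
  forall m (U : set 'rV[R]_m) (p : 'rV[R]_m -> X),
    plot DX U p -> plot DY U (f \o p).

Definition diffeomorphism (R : realType) (X Y : Type) (DX : diffeology R X)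
    (DY : diffeology R Y) (f : X -> Y) : Prop :=
  smooth DX DY f /\
  exists g : Y -> X, [/\ cancel f g, cancel g f & smooth DY DX g].

Definition D_open (R : realType) (X : Type) (D : diffeology R X)
    (A : set X) : Prop :=
  forall m (U : set 'rV[R]_m) (p : 'rV[R]_m -> X),
    plot D U p -> open (U `&` p @^-1` A).

Section StandardDiffeology.
Variables (R : realType) (W : normedModType R).

Let std_plot m (U : set 'rV[R]_m) (p : 'rV[R]_m -> W) : Prop :=
  open U /\ smooth_on U p.

Fact std_plot_open m (U : set 'rV[R]_m) p : std_plot U p -> open U.
Proof. by case. Qed.

Fact std_plot_ext m (U : set 'rV[R]_m) p q :
  {in U, p =1 q} -> std_plot U p -> std_plot U q.
Proof. by move=> pq [oU sp]; split=> // j; exact: Ck_ext (sp j). Qed.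

Fact std_plot_cst m (U : set 'rV[R]_m) x : open U -> std_plot U (fun=> x).
Proof. by move=> oU; split=> // j; exact: Ck_cst. Qed.

Fact std_plot_local m (U : set 'rV[R]_m) p : open U ->
  (forall u, U u -> exists U' : set 'rV[R]_m,
     [/\ open U', U' u, U' `<=` U & std_plot U' p]) -> std_plot U p.
Proof.
move=> oU H; split=> // j; apply: Ck_local => u /H[U' [_ U'u _ [_ sp]]].
by exists U' => //; exact: sp.
Qed.

Fact std_plot_comp m l (U : set 'rV[R]_m) (U' : set 'rV[R]_l) p
    (h : 'rV[R]_l -> 'rV[R]_m) :
  std_plot U p -> open U' -> smooth_on U' h -> h @` U' `<=` U ->
  std_plot U' (p \o h).
Proof.
move=> [oU sp] oU' sh hU; split=> // j.
by apply: Ck_comp (sp j) (sh j) => // x U'x; apply: hU; exists x.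
Qed.

(* Used for [W] finite-dimensional only: R^k and R itself. *)
Definition std_diffeology : diffeology R W :=
  Diffeology std_plot_open std_plot_ext std_plot_cst std_plot_local
    std_plot_comp.

End StandardDiffeology.

Section ProductDiffeology.
Variables (R : realType) (X Y : Type).
Variables (DX : diffeology R X) (DY : diffeology R Y).

Let prod_plot m (U : set 'rV[R]_m) (p : 'rV[R]_m -> X * Y) : Prop :=
  plot DX U (fst \o p) /\ plot DY U (snd \o p).

Fact prod_plot_open m (U : set 'rV[R]_m) p : prod_plot U p -> open U.
Proof. by case=> /plot_open. Qed.

Fact prod_plot_ext m (U : set 'rV[R]_m) p q :
  {in U, p =1 q} -> prod_plot U p -> prod_plot U q.
Proof.
move=> pq [p1 p2]; split; [apply: plot_ext p1|apply: plot_ext p2].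
all: by move=> u Uu /=; rewrite pq.
Qed.

Fact prod_plot_cst m (U : set 'rV[R]_m) z : open U -> prod_plot U (fun=> z).
Proof. by move=> oU; split; exact: plot_cst. Qed.

Fact prod_plot_local m (U : set 'rV[R]_m) p : open U ->
  (forall u, U u -> exists U' : set 'rV[R]_m,
     [/\ open U', U' u, U' `<=` U & prod_plot U' p]) -> prod_plot U p.
Proof.
by move=> oU H; split; apply: plot_local => // u /H[U' [? ? ? []]]; exists U'.
Qed.

Fact prod_plot_comp m l (U : set 'rV[R]_m) (U' : set 'rV[R]_l) p
    (h : 'rV[R]_l -> 'rV[R]_m) :
  prod_plot U p -> open U' -> smooth_on U' h -> h @` U' `<=` U ->
  prod_plot U' (p \o h).
Proof.
move=> [p1 p2] oU' sh hU.
by split; [exact: plot_comp p1 oU' sh hU|exact: plot_comp p2 oU' sh hU].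
Qed.

Definition prod_diffeology : diffeology R (X * Y) :=
  Diffeology prod_plot_open prod_plot_ext prod_plot_cst prod_plot_local
    prod_plot_comp.

End ProductDiffeology.

Section SubsetDiffeology.
Variables (R : realType) (X : Type) (D : diffeology R X) (A : set X).

Let sub_plot m (U : set 'rV[R]_m) (p : 'rV[R]_m -> A) : Prop :=
  plot D U (val \o p).

Fact sub_plot_open m (U : set 'rV[R]_m) p : sub_plot U p -> open U.
Proof. exact: plot_open. Qed.

Fact sub_plot_ext m (U : set 'rV[R]_m) p q :
  {in U, p =1 q} -> sub_plot U p -> sub_plot U q.
Proof. by move=> pq; apply: plot_ext => u Uu /=; rewrite pq. Qed.

Fact sub_plot_cst m (U : set 'rV[R]_m) a : open U -> sub_plot U (fun=> a).
Proof. exact: plot_cst. Qed.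

Fact sub_plot_local m (U : set 'rV[R]_m) p : open U ->
  (forall u, U u -> exists U' : set 'rV[R]_m,
     [/\ open U', U' u, U' `<=` U & sub_plot U' p]) -> sub_plot U p.
Proof. exact: plot_local. Qed.

Fact sub_plot_comp m l (U : set 'rV[R]_m) (U' : set 'rV[R]_l) p
    (h : 'rV[R]_l -> 'rV[R]_m) :
  sub_plot U p -> open U' -> smooth_on U' h -> h @` U' `<=` U ->
  sub_plot U' (p \o h).
Proof. exact: plot_comp. Qed.

Definition subset_diffeology : diffeology R A :=
  Diffeology sub_plot_open sub_plot_ext sub_plot_cst sub_plot_local
    sub_plot_comp.

End SubsetDiffeology.

Definition is_diffeological_vs (R : realType) (F : lmodType R)
    (D : diffeology R F) : Prop :=
  smooth (prod_diffeology D D) D (fun vw => vw.1 + vw.2) /\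
  smooth (prod_diffeology (std_diffeology R) D) D (fun rv => rv.1 *: rv.2).

(* A real vector space structure on each fibre of [pi]: [fib x] is a bijection
   from the vector space [fibre x] onto pi^-1(x), with inverse [coord x]; the
   values of [coord x] outside pi^-1(x) are irrelevant. *)
Record fibrewise_vs (R : realType) (V X : Type) (pi : V -> X) := FibrewiseVs {
  fibre : X -> lmodType R;
  fib : forall x, fibre x -> V;
  coord : forall x, V -> fibre x;
  fib_pi : forall x (a : fibre x), pi (fib a) = x;
  fibK : forall x, cancel (@fib x) (coord x);
  coordK : forall v, fib (coord (pi v) v) = v
}.

Section PseudoBundle.
Variables (R : realType) (V X : Type) (pi : V -> X) (E : fibrewise_vs R pi).

(* Only meaningful when [pi v = pi w]. *)
Definition fadd (v w : V) : V :=
  fib (coord E (pi v) v + coord E (pi v) w).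

Definition fscale (r : R) (v : V) : V := fib (r *: coord E (pi v) v).

Definition fzero (x : X) : V := fib (0 : fibre E x).

Variables (DV : diffeology R V) (DX : diffeology R X).

Definition fibre_product : set (V * V) := [set vw | pi vw.1 = pi vw.2].

Definition is_pseudo_bundle : Prop :=
  [/\ smooth DV DX pi,
      smooth (subset_diffeology (prod_diffeology DV DV) fibre_product) DV
        (fun z => fadd (val z).1 (val z).2),
      smooth (prod_diffeology (std_diffeology R) DV) DV
        (fun rv => fscale rv.1 rv.2) &
      smooth DX DV fzero].

Definition locally_trivial_at (x : X) : Prop :=
  exists U : set X, [/\ D_open DX U, U x &
    exists (F : lmodType R) (DF : diffeology R F)
        (phi : (pi @^-1` U) -> U * F),
      [/\ is_diffeological_vs DF,
          diffeomorphism (subset_diffeology DV (pi @^-1` U))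
            (prod_diffeology (subset_diffeology DX U) DF) phi,
          forall v, val (phi v).1 = pi (val v) &
          forall (r : R) (v w s : pi @^-1` U),
            pi (val v) = pi (val w) ->
            val s = fadd (fscale r (val v)) (val w) ->
            (phi s).2 = r *: (phi v).2 + (phi w).2]].

End PseudoBundle.

Section Projection.
Variables (R : realType) (k n : nat) (hkn : (k <= n)%N).

(* The identification R^n = R^k x R^(n-k) and its inverse. *)
Definition split_coords (v : 'rV[R]_n) : 'rV[R]_(k + (n - k)) :=
  castmx (erefl, esym (subnKC hkn)) v.

Definition join_coords (x : 'rV[R]_k) (a : 'rV[R]_(n - k)) : 'rV[R]_n :=
  castmx (erefl, subnKC hkn) (row_mx x a).

Definition proj_first (v : 'rV[R]_n) : 'rV[R]_k := lsubmx (split_coords v).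

Fact proj_join x a : proj_first (join_coords x a) = x.
Proof. by rewrite /proj_first /split_coords castmx_comp castmx_id row_mxKl. Qed.

Fact join_coordsK x :
  cancel (join_coords x) (fun v => rsubmx (split_coords v)).
Proof. by move=> a; rewrite /split_coords castmx_comp castmx_id row_mxKr. Qed.

Fact split_coordsK v : join_coords (proj_first v) (rsubmx (split_coords v)) = v.
Proof. by rewrite /join_coords hsubmxK castmx_comp castmx_id. Qed.

Definition proj_first_vs : fibrewise_vs R proj_first :=
  FibrewiseVs (fibre := fun=> 'rV[R]_(n - k))
    proj_join join_coordsK split_coordsK.

End Projection.

(* Main.v *)
Require Import Defs.
From mathcomp Require Import all_boot all_order all_algebra.
From mathcomp Require Import all_classical all_reals all_analysis.
Import numFieldNormedType.Exports.

(** The fibre of a locally trivial bundle has, up to diffeomorphism, the same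
    diffeology over all points of a trivialising neighbourhood. So it is enough
    to find a diffeology on R^n for which the fibre over the origin of R^k is
    not diffeomorphic to the nearby ones.

    Call a parametrization u |-> (f u, a u) of R^n = R^k x R^(n-k) a plot when
    f is smooth and a is continuous at every u with f u <> 0. The condition on a
    is imposed point by point, so these plots form a diffeology, and it is
    stable under sums and scalar multiples, so the projection is a pseudo-bundle
    ([coarse_at0_pseudo_bundle]). Over 0 nothing is asked of a: every map into
    that fibre is a plot. In a trivialisation near 0 with typical fibre F, the
    diffeology of F is therefore coarse as well, and then so is that of every
    nearby fibre ([typical_fibre_coarse], [trivial_fibre_plot]). But over a point
    x <> 0 plots in the fibre are continuous, and since n - k >= 1 there are
    discontinuous maps into R^(n-k). Since k >= 1, every neighbourhood of 0 in
    R^k contains such an x. *)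

Import Order.TTheory GRing.Theory Num.Theory.

Set Implicit Arguments.
Unset Strict Implicit.
Unset Printing Implicit Defensive.

Local Open Scope classical_set_scope.
Local Open Scope ring_scope.

Lemma nbhs0_nonzero (R : realType) m (A : set 'rV[R]_m) :
  (0 < m)%N -> nbhs (0 : 'rV[R]_m) A -> exists2 x, A x & x != 0.
Proof.
move=> m0 /nbhs_ballP[e /= e0 eA].
exists (const_mx (e / 2)).
  apply: eA; split=> // i j; rewrite !mxE /ball /= sub0r normrN.
  by rewrite gtr0_norm ?divr_gt0// gtr_pMr// invf_lt1// ltr1n.
apply/eqP => /matrixP/(_ 0 (Ordinal m0)); rewrite !mxE => /eqP.
by rewrite gt_eqF ?divr_gt0.
Qed.

Definition jump (R : realType) l (t : 'rV[R]_1) : 'rV[R]_l :=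
  if t == 0 then 0 else const_mx 1.

Lemma jump_discontinuous (R : realType) l :
  (0 < l)%N -> ~ {for (0 : 'rV[R]_1), continuous (@jump R l)}.
Proof.
move=> l0 cj.
pose i := Ordinal l0.
have ci : {for (0 : 'rV[R]_1), continuous (fun t => jump l t 0 i : R)}.
  apply: (@continuous_comp _ _ _ (@jump R l) (fun M : 'rV_l => M 0 i)) => //.
  exact: coord_continuous.
have : nbhs (0 : 'rV[R]_1) [set t | jump l t 0 i < 1].
  move: ci => /cvgr_lt; apply; by rewrite /jump eqxx mxE.
move=> /(nbhs0_nonzero (ltn0Sn 0))[t /= + /negPf t0].
by rewrite /jump t0 mxE ltxx.
Qed.

(** The identity of R^k is a plot. *)
Lemma std_D_open_nbhs (R : realType) k (U : set 'rV[R]_k) x :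
  D_open (std_diffeology 'rV[R]_k) U -> U x -> nbhs x U.
Proof.
move=> oU Ux; apply: open_nbhs_nbhs; split=> //.
rewrite -[U]setTI; apply: (oU k setT id).
split; first exact: openT.
case=> [|j]; first by move=> y _; exact: cvg_id.
split=> // v.
rewrite (_ : 'D_v _ = fun=> v); first exact: Ck_cst.
by apply/funext => y; rewrite derive_id.
Qed.

Section CoarseAtZero.
Variables (R : realType) (k n : nat) (hkn : (k <= n)%N).

Let base : 'rV[R]_n -> 'rV[R]_k := proj_first hkn.

Definition fibre_coord (v : 'rV[R]_n) : 'rV[R]_(n - k) :=
  rsubmx (split_coords hkn v).

Let plot0 m (U : set 'rV[R]_m) (p : 'rV[R]_m -> 'rV[R]_n) : Prop :=
  plot (std_diffeology 'rV[R]_k) U (base \o p) /\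
  forall u, U u -> base (p u) != 0 -> {for u, continuous (fibre_coord \o p)}.

Fact plot0_open m (U : set 'rV[R]_m) p : plot0 U p -> open U.
Proof. by case=> /plot_open. Qed.

Fact plot0_ext m (U : set 'rV[R]_m) p q :
  {in U, p =1 q} -> plot0 U p -> plot0 U q.
Proof.
move=> pq [bp cp]; split.
  by apply: plot_ext bp => u Uu /=; rewrite pq.
move=> u Uu; rewrite -pq; last exact/mem_set.
move=> /(cp _ Uu); apply: near_eq_continuous.
near=> y; rewrite /= pq//; apply/mem_set; near: y.
by apply: open_nbhs_nbhs; split=> //; exact: plot_open bp.
Unshelve. all: by end_near. Qed.

Fact plot0_cst m (U : set 'rV[R]_m) v : open U -> plot0 U (fun=> v).
Proof.
move=> oU; split; first exact: (plot_cst (std_diffeology 'rV[R]_k)).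
by move=> u _ _; exact: cst_continuous.
Qed.

Fact plot0_local m (U : set 'rV[R]_m) p : open U ->
  (forall u, U u -> exists U' : set 'rV[R]_m,
     [/\ open U', U' u, U' `<=` U & plot0 U' p]) -> plot0 U p.
Proof.
move=> oU H; split.
  by apply: plot_local => // u /H[U' [? ? ? []]]; exists U'.
by move=> u /H[U' [_ U'u _ [_ cp]]]; exact: cp.
Qed.

Fact plot0_comp m l (U : set 'rV[R]_m) (U' : set 'rV[R]_l) p
    (h : 'rV[R]_l -> 'rV[R]_m) :
  plot0 U p -> open U' -> smooth_on U' h -> h @` U' `<=` U ->
  plot0 U' (p \o h).
Proof.
move=> [bp cp] oU' sh hU; split; first exact: plot_comp bp oU' sh hU.
move=> u U'u bu.
apply: (@continuous_comp _ _ _ h (fibre_coord \o p)); first exact: (sh 0%N).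
by apply: cp => //; apply: hU; exists u.
Qed.

Definition coarse_at0 : diffeology R 'rV[R]_n :=
  Diffeology plot0_open plot0_ext plot0_cst plot0_local plot0_comp.

Local Notation E := (proj_first_vs R hkn).
Local Notation DX := (std_diffeology 'rV[R]_k).

Lemma base_smooth : smooth coarse_at0 DX (proj_first hkn).
Proof. by move=> m U p []. Qed.

Lemma coarse_at0_pseudo_bundle : is_pseudo_bundle E coarse_at0 DX.
Proof.
split; first exact: base_smooth.
- move=> m U p [[b1 c1] [_ c2]]; split.
    by apply: plot_ext b1 => u _; rewrite /= /fadd /base proj_join.
  move=> u Uu /=; rewrite /fadd /base proj_join => bu.
  have bu2 : base (val (p u)).2 != 0 by rewrite /base -(set_mem (valP (p u))).
  rewrite (_ : fibre_coord \o _ =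
      fun y => fibre_coord (val (p y)).1 + fibre_coord (val (p y)).2); last first.
    by apply/funext => y; rewrite /= /fibre_coord join_coordsK.
  by apply: continuousD; [exact: c1|exact: c2].
- move=> m U p [[_ sr] [b c]]; split.
    by apply: plot_ext b => u _; rewrite /= /fscale /base proj_join.
  move=> u Uu /=; rewrite /fscale /base proj_join => bu.
  rewrite (_ : fibre_coord \o _ =
      fun y => (p y).1 *: fibre_coord (p y).2); last first.
    by apply/funext => y; rewrite /= /fibre_coord join_coordsK.
  by apply: continuousZ; [exact: (sr 0%N)|exact: c].
- move=> m U p bp; split.
    by apply: plot_ext bp => u _; rewrite /= /fzero /base proj_join.
  move=> u _ _.
  rewrite (_ : fibre_coord \o _ = fun=> 0); last first.
    by apply/funext => y; rewrite /= /fibre_coord join_coordsK.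
  exact: cst_continuous.
Qed.

Section Trivialisation.
Variables (U : set 'rV[R]_k) (F : lmodType R) (DF : diffeology R F).
Variables (phi : proj_first hkn @^-1` U -> U * F).
Hypothesis dphi : diffeomorphism
  (subset_diffeology coarse_at0 (proj_first hkn @^-1` U))
  (prod_diffeology (subset_diffeology DX U) DF) phi.
Hypothesis phi_base : forall v, val (phi v).1 = proj_first hkn (val v).

(** A curve c in F is moved by the inverse of the trivialisation into the fibre
    over 0, where it is a plot, and is the F-component of its image. *)
Lemma typical_fibre_coarse (c : 'rV[R]_1 -> F) : U 0 -> plot DF setT c.
Proof.
move=> U0; have [sphi [g [gK Kg _]]] := dphi.
pose z : U := exist _ 0 (mem_set U0).
have bg t : base (val (g (z, c t))) = 0 by rewrite /base -phi_base Kg.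
have /sphi[_] :
    plot (subset_diffeology coarse_at0 (proj_first hkn @^-1` U)) setT
      (fun t => g (z, c t)).
  split; last by move=> t _ /eqP[]; exact: bg.
  apply: (@plot_ext _ _ _ _ _ (fun=> 0)); last exact/plot_cst/openT.
  by move=> t _; apply: esym; exact: bg.
by apply: plot_ext => t _; rewrite /= Kg.
Qed.

(** The parametrization is the image under the inverse trivialisation of the
    pair of the constant x and a curve in F, which is a plot because F is
    coarse. *)
Lemma trivial_fibre_plot (x : 'rV[R]_k) (q : 'rV[R]_1 -> 'rV[R]_(n - k)) :
  U 0 -> U x -> plot coarse_at0 setT (fun t => join_coords hkn x (q t)).
Proof.
move=> U0 Ux; have [_ [g [gK _ sg]]] := dphi.
have Uq t : (proj_first hkn @^-1` U) (join_coords hkn x (q t)).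
  by rewrite /= proj_join.
pose v t : proj_first hkn @^-1` U :=
    exist _ (join_coords hkn x (q t)) (mem_set (Uq t)).
have : plot (prod_diffeology (subset_diffeology DX U) DF) setT (phi \o v).
  split; last exact: typical_fibre_coarse.
  apply: (@plot_ext _ _ (subset_diffeology DX U) _ _
    (fun=> exist _ x (mem_set Ux))); last exact/plot_cst/openT.
  by move=> t _; apply/val_inj; rewrite /= phi_base /= proj_join.
move=> /sg pv.
suff -> : (fun t => join_coords hkn x (q t)) = val \o (g \o (phi \o v)) by [].
by apply/funext => t; rewrite /= gK.
Qed.

End Trivialisation.

Lemma coarse_at0_nontrivial :
  (0 < k)%N -> (k < n)%N -> ~ locally_trivial_at E coarse_at0 DX 0.
Proof.
move=> k0 kn [U [oU U0 [F [DF [phi [_ dphi phi_base _]]]]]].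
have [x Ux x0] := nbhs0_nonzero k0 (std_D_open_nbhs oU U0).
have [_ /(_ 0 I)] := trivial_fibre_plot dphi phi_base (@jump R (n - k)) U0 Ux.
rewrite /base proj_join => /(_ x0).
have -> : fibre_coord \o (fun t => join_coords hkn x (jump (n - k) t)) =
    @jump R (n - k).
  by apply/funext => t; rewrite /= /fibre_coord join_coordsK.
by apply: jump_discontinuous; rewrite subn_gt0.
Qed.

End CoarseAtZero.

Theorem mainTheorem5 (R : realType) (k n : nat)
    (hk : (1 <= k)%N) (hkn : (k < n)%N) :
  exists D : diffeology R 'rV[R]_n,
    [/\ smooth D (std_diffeology 'rV[R]_k) (proj_first (ltnW hkn)),
        is_pseudo_bundle (proj_first_vs R (ltnW hkn)) D
          (std_diffeology 'rV[R]_k) &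
        exists x : 'rV[R]_k,
          ~ locally_trivial_at (proj_first_vs R (ltnW hkn)) D
              (std_diffeology 'rV[R]_k) x].
Proof.
exists (coarse_at0 R (ltnW hkn)); split.
- exact: base_smooth.
- exact: coarse_at0_pseudo_bundle.
- by exists 0; exact: coarse_at0_nontrivial.
Qed.
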